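(* Let $n,k,r,d$ be integers with $n\ge k\ge r>d\ge 0$. Then $${n\brace k}_{r,d} = \frac{1}{(k-r)!}\sum_{j=0}^{k-r}(-1)^j\binom{k-r}{j}(k-d-j)^{n-r}.$$
   Context: For non-negative integers $n,k,r,d$ with $n\ge r$, ${n\brace k}_{r,d}$ (the $(r,d)$-Stirling number of the second kind) denotes the number of partitions of $\{1,\dots,n\}$ into $k$ non-empty subsets such that the elements $1,\dots,r$ lie in pairwise different subsets and any two distinct elements $i,j$ in the same subset satisfy $|i-j|>d$. *)

(* Defs.v *)
From mathcomp Require Import all_boot all_order all_algebra.

Set Implicit Arguments.
Unset Strict Implicit.
Unset Printing Implicit Defensive.

(* The ground set {1, ..., n} is represented by 'I_n: the element m + 1 of the
   former is the ordinal of value m. Hence the elements 1, ..., r are the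
   ordinals i with i < r, and differences of elements are unchanged. *)

Definition separates_first (n r : nat) (P : {set {set 'I_n}}) : bool :=
  [forall i : 'I_n, forall j : 'I_n,
    [&& i < r, j < r & i != j] ==> (pblock P i != pblock P j)].

(* In `|i - j| the subtraction is that of int, not truncated subtraction. *)
Definition min_gap (n d : nat) (P : {set {set 'I_n}}) : bool :=
  [forall B in P, forall i in B, forall j in B,
    (i != j) ==> (d < `|i - j|)].

(* The (r,d)-Stirling number of the second kind; only meaningful for r <= n. *)
Definition stirling2_rd (n k r d : nat) : nat :=
  #|[set P : {set {set 'I_n}} |
      [&& partition P [set: 'I_n], #|P| == k,
          separates_first r P & min_gap d P]]|.

(* Main.v *)
Require Import Defs.
From mathcomp Require Import all_boot all_order all_algebra.
From mathcomp Require Import zify.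
Import GRing.Theory Num.Theory.

(** The partitions counted by the (r,d)-Stirling number are the partitions
    into k independent sets of the graph on {0, ..., n-1} in which i and j are
    adjacent when both are less than r or when they are at distance at most d.
    The formula comes from counting the proper colourings of this graph with q
    colours in two ways.

    On the one hand, colour the vertices in increasing order. The first r
    vertices form a clique and use q ^_ r colourings; afterwards, as d < r, the
    earlier neighbours of a vertex are exactly its d predecessors, which are
    pairwise adjacent and so carry d distinct colours. There are therefore
    q ^_ r * (q - d) ^ (n - r) colourings [card_proper_conflict].

    On the other hand, the colour classes of a proper colouring form a
    partition P into independent sets, and P arises from q ^_ #|P| colourings,
    the injections of its blocks into the colours
    [card_proper_colouring_stable].

    The number of colourings is thus a combination of falling factorials of q
    whose coefficients are the numbers of partitions sought. The identity
    'C(k, j) * (k - j) ^_ i = k ^_ i * 'C(k - i, j) shows that the k-th finite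
    difference at 0 annihilates every falling factorial except the k-th, and
    so isolates k! times the wanted coefficient [card_stable_partition]. The
    same identity with i = r, applied to the explicit count of colourings,
    factors k ^_ r out of that finite difference, and
    k! = k ^_ r * (k - r)!. *)

(** * Proper colourings and partitions into independent sets *)

Definition proper_colouring {V C : finType} (e : rel V) (f : {ffun V -> C}) :=
  [forall x, forall y, e x y ==> (f x != f y)].

Definition stable_partition {V : finType} (e : rel V) (P : {set {set V}}) :=
  partition P [set: V] &&
    [forall x, forall y, e x y ==> (pblock P x != pblock P y)].

Definition kernel_partition {V C : finType} (f : {ffun V -> C}) :
  {set {set V}} := preim_partition f [set: V].

Lemma eq_pblock_kernel (V C : finType) (f : {ffun V -> C}) x y :
  (pblock (kernel_partition f) x == pblock (kernel_partition f) y)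
    = (f x == f y).
Proof.
have partK : partition (kernel_partition f) [set: V] by apply: preim_partitionP.
have triv : trivIset (kernel_partition f) by case/and3P: partK.
rewrite eq_pblock ?(cover_partition partK) ?inE //.
rewrite pblock_equivalence_partition ?inE // => a b c _ _ _.
by split=> // /eqP->.
Qed.

(** A map has the blocks of P as its fibres exactly when it factors through
    the block map x |-> pblock P x by an injection; composition with the block
    map is a bijection from these injections. *)
Lemma card_kernel_partition (V C : finType) (P : {set {set V}}) :
  partition P [set: V] ->
  #|[set f : {ffun V -> C} | kernel_partition f == P]| = #|C| ^_ #|P|.
Proof.
move=> partP.
have coverP x : x \in cover P by rewrite (cover_partition partP) inE.
have triv : trivIset P by case/and3P: partP.
pose block := {B : {set V} | B \in P}.
pose blk x : block := Sub (pblock P x) (pblock_mem (coverP x)).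
have blk_ex (b : block) : exists x, x \in val b.
  apply/set0Pn/eqP => b0; case/and3P: partP => _ _ /negP[].
  by rewrite -b0 (valP b).
(* A section of the block map, which exists because blocks are nonempty. *)
pose pt b := xchoose (blk_ex b).
have ptK b : blk (pt b) = b.
  by apply: val_inj; apply: def_pblock (valP b) (xchooseP (blk_ex b)).
pose colour (h : {ffun block -> C}) : {ffun V -> C} := [ffun x => h (blk x)].
have colour_inj : injective colour.
  move=> h h' eq_hh'; apply/ffunP=> b.
  have := congr1 (fun f : {ffun V -> C} => f (pt b)) eq_hh'.
  by rewrite !ffunE ptK.
have -> : [set f : {ffun V -> C} | kernel_partition f == P]
        = colour @: [set h : {ffun block -> C} | injectiveb h].
  apply/setP=> f; rewrite inE; apply/eqP/imsetP => [kerf | [h + ->]].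
    have eq_f x y : (pblock P x == pblock P y) = (f x == f y).
      by rewrite -kerf eq_pblock_kernel.
    exists [ffun b => f (pt b)].
      rewrite inE; apply/injectiveP=> b b'; rewrite !ffunE => /eqP.
      rewrite -eq_f => /eqP eqb; rewrite -(ptK b) -(ptK b').
      exact: val_inj.
    apply/ffunP=> x; rewrite !ffunE; apply/eqP; rewrite -eq_f; apply/eqP.
    exact/esym/(congr1 val (ptK (blk x))).
  rewrite inE => /injectiveP h_inj.
  rewrite -[RHS](preim_partition_pblock partP).
  rewrite /kernel_partition /preim_partition /equivalence_partition.
  apply: eq_imset => x; apply/setP=> y; rewrite !inE !ffunE /=.
  by rewrite (inj_eq h_inj).
by rewrite card_imset // card_inj_ffuns card_sig.
Qed.

(** Properness of a colouring depends only on its fibres, so the colourings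
    can be sorted by the partition they induce: this is the expansion of the
    chromatic polynomial in falling factorials. *)
Lemma card_proper_colouring_stable (V C : finType) (e : rel V) :
  #|[set f : {ffun V -> C} | proper_colouring e f]|
    = \sum_(P | stable_partition e P) #|C| ^_ #|P|.
Proof.
have stableK (f : {ffun V -> C}) :
    stable_partition e (kernel_partition f) = proper_colouring e f.
  rewrite /stable_partition preim_partitionP /=.
  by apply: eq_forallb => x; apply: eq_forallb => y; rewrite eq_pblock_kernel.
rewrite -sum1dep_card (partition_big kernel_partition (stable_partition e)) /=;
  last by move=> f; rewrite stableK.
apply: eq_bigr => P stP; rewrite sum1dep_card.
have /andP[partP _] := stP; rewrite -(card_kernel_partition V C P partP).
apply: eq_card => f; rewrite !inE andbC -stableK.
by case: eqP => // ->.
Qed.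

(** * Finite differences of falling factorials *)

(** After multiplication by j!, both sides are k ^_ (i + j): choosing j and
    then i entries, or i and then j, in an injective word of length i + j. *)
Lemma mul_bin_ffact k i j : 'C(k, j) * (k - j) ^_ i = k ^_ i * 'C(k - i, j).
Proof.
have ffactD a b : k ^_ (a + b) = k ^_ a * (k - a) ^_ b.
  elim: b => [|b IHb]; first by rewrite addn0 ffactn0 muln1.
  by rewrite addnS !ffactnSr IHb subnDA mulnA.
apply/eqP; rewrite -(eqn_pmul2r (fact_gt0 j)) mulnAC bin_ffact -ffactD.
by rewrite -mulnA bin_ffact -ffactD addnC.
Qed.

Local Open Scope ring_scope.

Lemma alternating_sum_bin (R : comNzRingType) (m n : nat) : (m <= n)%N ->
  \sum_(0 <= j < n.+1) (-1) ^+ j * 'C(m, j)%:R = (m == 0)%:R :> R.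
Proof.
move=> le_mn; rewrite (@big_cat_nat _ _ _ m.+1) //= [X in _ + X]big_nat_cond.
rewrite [X in _ + X]big1 => [|j]; last first.
  by rewrite andbT => /andP[lt_mj _]; rewrite bin_small // mulr0n mulr0.
have := exprDn (1 : R) (-1) m; rewrite subrr expr0n addr0 => ->.
rewrite big_mkord; apply: eq_bigr => j _.
by rewrite expr1n mul1r mulr_natr.
Qed.

(** By [mul_bin_ffact] the sum is k ^_ i times an alternating row sum of
    Pascal's triangle, which is zero unless k <= i; and k ^_ i is zero when
    k < i. *)
Lemma alternating_sum_bin_ffact (R : comNzRingType) (k i : nat) :
  \sum_(0 <= j < k.+1) (-1) ^+ j * 'C(k, j)%:R * ((k - j) ^_ i)%:R
    = if i == k then k`!%:R else 0 :> R.
Proof.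
under eq_bigr => j _ do
  rewrite -mulrA -natrM mul_bin_ffact natrM mulrCA.
rewrite -big_distrr /= alternating_sum_bin ?leq_subr // subn_eq0.
case: ltngtP => [lt_ki | lt_ik | ->].
- by rewrite ffact_small // mulr0n mul0r.
- by rewrite mulr0.
- by rewrite ffactnn mulr1.
Qed.

(** Inversion of [card_proper_colouring_stable], by taking the k-th finite
    difference at 0 of its right-hand side. It is also inclusion-exclusion on
    the missed colours: both sides count the proper colourings that use all
    of k colours. *)
Lemma card_stable_partition (R : comNzRingType) (V : finType) (e : rel V) k :
  (k`! * #|[set P | stable_partition e P & #|P| == k]|)%:R
    = \sum_(0 <= j < k.+1) (-1) ^+ j * 'C(k, j)%:R *
        #|[set f : {ffun V -> 'I_(k - j)} | proper_colouring e f]|%:R :> R.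
Proof.
under [RHS]eq_bigr => j _ do
  rewrite card_proper_colouring_stable card_ord natr_sum big_distrr /=.
rewrite exchange_big /=.
under eq_bigr => P _ do rewrite alternating_sum_bin_ffact.
rewrite -big_mkcondr sumr_const -[RHS]mulr_natr -natrM; congr (_ * _)%:R.
by apply: eq_card => P; rewrite !inE.
Qed.

(** * The conflict graph of the (r,d)-Stirling numbers *)

(** Subtraction being truncated, the last two inequalities together say that
    the distance of i and j is at most d. *)
Definition conflict {n : nat} (r d : nat) (i j : 'I_n) : bool :=
  (i != j) && ((i < r)%N && (j < r)%N || (j - i <= d)%N && (i - j <= d)%N).

Lemma stirling2_rd_stable (n k r d : nat) :
  stirling2_rd n k r d
    = #|[set P | stable_partition (@conflict n r d) P & #|P| == k]|.
Proof.
apply: eq_card => P; rewrite !inE /stable_partition.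
case partP: (partition P _) => //=; rewrite andbC; congr (_ && _).
have coverP x : x \in cover P by rewrite (cover_partition partP) inE.
have triv : trivIset P by case/and3P: partP.
apply/andP/forallP => [[sepP gapP] i | stP].
  apply/forallP=> j; apply/implyP; case/andP=> ij /orP[ijr | ijd].
    move/forallP/(_ i)/forallP/(_ j)/implyP: sepP; apply.
    by case/andP: ijr => -> ->.
  apply/negP=> eqP; move: ijd; rewrite eq_pblock // in eqP.
  move/forall_inP/(_ _ (pblock_mem (coverP i))): gapP.
  move/forall_inP/(_ i); rewrite mem_pblock => /(_ (coverP i)).
  move/forall_inP/(_ j eqP); rewrite ij /=; lia.
split.
  apply/forallP=> i; apply/forallP=> j; apply/implyP=> /and3P[ir jr ij].
  by move/(_ i)/forallP/(_ j)/implyP: stP; apply; rewrite /conflict ij ir jr.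
apply/forall_inP=> B BP; apply/forall_inP=> i iB; apply/forall_inP=> j jB.
apply/implyP=> ij; move/(_ i)/forallP/(_ j)/implyP: stP.
rewrite (def_pblock triv BP iB) (def_pblock triv BP jB) eqxx /conflict ij /=.
by case: (ltnP d) => // ? /(_ _)/negP; lia.
Qed.

Local Open Scope nat_scope.

(** The first r vertices form a clique. *)
Lemma card_proper_conflict_init (r d q : nat) :
  #|[set f : {ffun 'I_r -> 'I_q} | proper_colouring (conflict r d) f]|
    = q ^_ r.
Proof.
have := card_inj_ffuns 'I_r 'I_q; rewrite !card_ord => <-.
apply: eq_card => f; rewrite !inE.
apply/forallP/injectiveP => [prop i j fij | inj i].
  apply/eqP/negPn/negP=> ij; move/(_ i)/forallP/(_ j): prop.
  by rewrite /conflict ij !ltn_ord fij eqxx.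
by apply/forallP=> j; rewrite (inj_eq inj); apply/implyP=> /andP[].
Qed.

Lemma card_last_ords (n d : nat) : d <= n ->
  #|[set i : 'I_n | n - i <= d]| = d.
Proof.
move=> /subnK <-; set m := n - d.
have -> : [set i : 'I_(m + d) | m + d - i <= d] = [set rshift m i | i : 'I_d].
  apply/setP=> i; rewrite inE; apply/idP/imsetP => [le_d | [j _ ->]]; last first.
    by rewrite /=; lia.
  case: (split_ordP i) => j eq_i; last by exists j.
  by move: le_d (ltn_ord j); rewrite eq_i /=; lia.
by rewrite card_imset ?card_ord //; apply: rshift_inj.
Qed.

(** A proper colouring of the first n vertices extends to vertex n by any
    colour not used on the d vertices before it. These are all its neighbours
    since n >= r, and they carry d distinct colours since any two of them are
    at distance less than d. *)
Lemma card_proper_conflict_last (n r d q : nat) : d < r -> r <= n ->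
  #|[set f : {ffun 'I_n.+1 -> 'I_q} | proper_colouring (conflict r d) f]|
    = #|[set f : {ffun 'I_n -> 'I_q} | proper_colouring (conflict r d) f]|
        * (q - d).
Proof.
move=> dr rn.
pose extend (p : {ffun 'I_n -> 'I_q} * 'I_q) : {ffun 'I_n.+1 -> 'I_q} :=
  [ffun i => oapp p.1 p.2 (unlift ord_max i)].
pose restrict (f : {ffun 'I_n.+1 -> 'I_q}) : {ffun 'I_n -> 'I_q} * 'I_q :=
  ([ffun i => f (lift ord_max i)], f ord_max).
have extendK : cancel extend restrict.
  move=> [g c]; congr (_, _); last by rewrite ffunE unlift_none.
  by apply/ffunP=> i; rewrite !ffunE liftK.
have restrictK : cancel restrict extend.
  move=> f; apply/ffunP=> i; rewrite ffunE.
  by case: unliftP => [j|] -> //=; rewrite ffunE.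
pose recent : {set 'I_n} := [set i : 'I_n | n - i <= d].
have card_recent : #|recent| = d by apply: card_last_ords; lia.
have properE g c : proper_colouring (conflict r d) (extend (g, c))
    = proper_colouring (conflict r d) g && (c \notin g @: recent).
  have extend_max : extend (g, c) ord_max = c by rewrite ffunE unlift_none.
  have extend_lift i : extend (g, c) (lift ord_max i) = g i.
    by rewrite ffunE liftK.
  apply/forallP/andP => [prop | [/forallP propg freshc]].
    split.
      apply/forallP=> i; apply/forallP=> j.
      move/(_ (lift ord_max i))/forallP/(_ (lift ord_max j)): prop.
      by rewrite /conflict (inj_eq lift_inj) !lift_max !extend_lift.
    apply/negP=> /imsetP[i]; rewrite inE => i_recent eq_c.
    move/(_ (lift ord_max i))/forallP/(_ ord_max)/implyP: prop.
    rewrite /conflict lift_max extend_max extend_lift -eq_c eqxx.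
    rewrite eq_sym neq_lift i_recent /=.
    by have := ltn_ord i; move=> ? /(_ _)/negP; lia.
  have fresh j : conflict r d (lift ord_max j) ord_max -> g j != c.
    rewrite /conflict lift_max => confl; apply: contraNneq freshc => <-.
    by apply: imset_f; rewrite inE; move: confl => /=; lia.
  move=> i; apply/forallP=> j; apply/implyP.
  case: (unliftP ord_max i) => [i'|] ->; case: (unliftP ord_max j) => [j'|] ->;
    rewrite ?extend_max ?extend_lift.
  - move=> confl; move/(_ i')/forallP/(_ j')/implyP: propg; apply.
    by move: confl; rewrite /conflict (inj_eq lift_inj) !lift_max.
  - exact: fresh.
  - rewrite eq_sym => confl; apply: fresh; move: confl.
    by rewrite /conflict eq_sym [(_ < r) && _]andbC [(_ <= d) && _]andbC.
  - by rewrite /conflict eqxx.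
rewrite -sum1dep_card (reindex extend) /=; last first.
  by exists restrict => x _; rewrite ?extendK ?restrictK.
transitivity (\sum_(g : {ffun 'I_n -> 'I_q} | proper_colouring (conflict r d) g)
                \sum_(c | c \notin g @: recent) 1).
  by rewrite pair_big_dep; apply: eq_bigl => -[g c]; rewrite properE.
rewrite -sum1dep_card big_distrl /=; apply: eq_bigr => g /forallP propg.
rewrite mul1n sum1_card.
have -> : #|[pred c | c \notin g @: recent]| = #|~: (g @: recent)|.
  by apply: eq_card => c; rewrite !inE.
rewrite cardsCs setCK card_ord card_in_imset ?card_recent // => i j.
rewrite !inE => i_recent j_recent gij; apply/eqP/negPn/negP=> ij.
move/(_ i)/forallP/(_ j): propg; rewrite gij eqxx /conflict ij /=.
have := ltn_ord i; have := ltn_ord j; lia.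
Qed.

Lemma card_proper_conflict (n r d q : nat) : d < r -> r <= n ->
  #|[set f : {ffun 'I_n -> 'I_q} | proper_colouring (conflict r d) f]|
    = q ^_ r * (q - d) ^ (n - r).
Proof.
move=> dr /subnK <-; rewrite addnK.
elim: (n - r) => [|m IHm]; first by rewrite card_proper_conflict_init muln1.
by rewrite addSn card_proper_conflict_last ?leq_addl // IHm expnSr mulnA.
Qed.

Local Open Scope ring_scope.

Theorem theorem1p7 (n k r d : nat) :
  (k <= n)%N -> (r <= k)%N -> (d < r)%N ->
  (stirling2_rd n k r d)%:R =
    ((k - r)`!%:R)^-1 *
      \sum_(0 <= j < (k - r).+1)
        (-1) ^+ j * 'C(k - r, j)%:R * (k%:R - d%:R - j%:R) ^+ (n - r) :> rat.
Proof.
move=> le_kn le_rk lt_dr; have le_rn := leq_trans le_rk le_kn.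
have ffact_neq0 : (k ^_ r)%:R != 0 :> rat by rewrite pnatr_eq0 -lt0n ffact_gt0.
have fact_neq0 : (k - r)`!%:R != 0 :> rat by rewrite pnatr_eq0 -lt0n fact_gt0.
(* Multiplying by k ^_ r * (k - r)! = k! clears the denominator. *)
apply: (mulfI (mulf_neq0 ffact_neq0 fact_neq0)).
rewrite [RHS]mulrA mulfK // -natrM ffact_fact // -natrM stirling2_rd_stable.
rewrite card_stable_partition.
(* With k - j < r colours the clique on the first r vertices cannot be
   coloured, so the sum stops at j = k - r. *)
rewrite (@big_cat_nat _ _ _ (k - r).+1) ?ltnS ?leq_subr //=.
rewrite [X in _ + X]big_nat_cond [X in _ + X]big1 => [|j]; last first.
  rewrite andbT => /andP[lt_j _]; rewrite card_proper_conflict //.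
  by rewrite ffact_small ?mul0n ?mulr0 //; lia.
rewrite addr0 big_distrr /=; apply: eq_big_nat => j /andP[_ lt_j].
rewrite card_proper_conflict // -mulrA -natrM mulnA mul_bin_ffact !natrM natrX.
rewrite mulrCA !natrB; [|lia|lia].
by rewrite [_ - j%:R - _]addrAC -!mulrA; congr (_ * _); rewrite mulrCA.
Qed.
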